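(* For an odd prime $p$ and positive integers $t,s$, put $r=p^t$, $q=r^s$, $T=q+1$, let $\eta$ be the quadratic multiplicative character of $\mathbb{F}_r$ (with $\eta(0)=0$), $D=\{x\in\mathbb{F}_{q^2}:\eta(\mathrm{Tr}_{q/r}(x^T))=-1\}$, $K=\#D=\frac{q(q+1)(r-1)}{2r}$, $N=q^2$, and consider the codebook $\mathcal{C}=\{\mathbf{c}_a=\frac{1}{\sqrt K}(\zeta_p^{\mathrm{Tr}_{q^2/p}(ax)})_{x\in D}: a\in\mathbb{F}_{q^2}\}$ with $\zeta_p=e^{2\pi i/p}$. Let $I_{max}(\mathcal{C})=\max_{a\neq a'}|\mathbf{c}_a\mathbf{c}_{a'}^H|$ and let $I_W=\sqrt{\frac{N-K}{(N-1)K}}$ be the Welch bound. Then $\frac{I_{max}(\mathcal{C})}{I_W}\to1$ as $r\to\infty$; that is, for every sequence of such parameter triples $(p,t,s)$ with $r=p^t\to\infty$, the ratio tends to $1$.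
   Context: $\mathrm{Tr}_{q/r}$ is the trace from $\mathbb{F}_q$ to $\mathbb{F}_r$, $\mathrm{Tr}_{q^2/p}$ the absolute trace of $\mathbb{F}_{q^2}$; $\mathbf{c}^H$ is the conjugate transpose. *)

(* Defs.v *)
From HB Require Import structures.
From mathcomp Require Import all_boot all_order all_algebra all_field.
From mathcomp Require Import all_classical all_reals all_analysis.
From mathcomp Require Import complex.
Set Implicit Arguments. Unset Strict Implicit. Unset Printing Implicit Defensive.
Import Order.TTheory GRing.Theory Num.Theory.
Local Open Scope ring_scope.

Section Codebook.
Variables (F : finFieldType) (p t s : nat) (R : realType).

Definition rr : nat := (p ^ t)%N.
Definition qq : nat := (rr ^ s)%N.
Definition TT : nat := (qq + 1)%N.
Definition NN : nat := (qq ^ 2)%N.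

(* Tr_{q/r}(y) = y + y^r + ... + y^(r^(s-1)), for y in F_q *)
Definition trQR (y : F) : F := \sum_(i < s) y ^+ (rr ^ i).

Definition trAbs (y : F) : F := \sum_(i < (2 * (t * s))%N) y ^+ (p ^ i).

(* quadratic character of F_r (F_r = {z | z^r = z}), eta(0) = 0 *)
Definition etaQ (y : F) : int :=
  if y == 0 then 0
  else if [exists z : F, (z ^+ rr == z) && (z ^+ 2 == y)] then 1 else -1.

Definition Dset : {set F} := [set x : F | etaQ (trQR (x ^+ TT)) == -1].
Definition KK : nat := #|Dset|.

Definition primeFieldNat (y : F) : nat :=
  odflt 0%N (omap (@nat_of_ord p) [pick k : 'I_p | (k%:R : F) == y]).

Definition zetap : R[i] :=
  Complex (cos (2 * pi / p%:R)) (sin (2 * pi / p%:R)).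

Definition cw (a x : F) : R[i] :=
  (Complex (Num.sqrt (KK%:R : R))^-1 0) * zetap ^+ primeFieldNat (trAbs (a * x)).

Definition corr (a a' : F) : R[i] :=
  \sum_(x in Dset) cw a x * conjc (cw a' x).

Definition Imax : R :=
  \big[Num.max/0]_(a : F) \big[Num.max/0]_(a' : F | a' != a)
     Normc.normc (corr a a').

Definition welch : R :=
  Num.sqrt (((NN%:R : R) - KK%:R) / (((NN%:R : R) - 1) * KK%:R)).

Definition codebookRatio : R := Imax / welch.

End Codebook.

(* Main.v *)
(** Put r = p^t, q = r^s, let k and E be the subfields of order r and q, and let
    Q(x) = Tr_{q/r}(x^(q+1)).  Completing the square in the Hermitian form
    y x^(q+1) + bx + (bx)^q turns the character sum twisted by y in k^* into
    -q psi_r(-Q(b)/y).  The indicator of a nonsquare c of k is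
    1 - (#{z in k : z^2 = c} + [c = 0]) / 2, so summing over the levels z^2 and
    0 of Q, instead of evaluating Gauss sums, gives for S(b) = sum_(x in D) psi(bx)
      2 r S(b) = (r-1) q^2 [b = 0] + q (r nu - r + r [Q(b) = 0] - 1),
    with nu = #{z in k : z^2 = -Q(b)}.  Taking b = 0 yields K; for b <> 0 it
    gives |S(b)| = q (r-1) / 2r or q (r+1) / 2r, hence
      (r-1)/(r+2) <= Imax / welch <= (r+1)/(r-1). *)

Require Import Defs.
From HB Require Import structures.
From mathcomp Require Import all_boot all_order all_algebra all_field.
From mathcomp Require Import all_classical all_reals all_analysis.
From mathcomp Require Import complex.
From mathcomp Require Import ring lra.
Import Order.TTheory GRing.Theory Num.Theory.
Import numFieldNormedType.Exports.
Local Open Scope classical_set_scope.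
Local Open Scope ring_scope.

(** * Fibres of power maps in a finite field *)

Lemma card_poly_roots (F : finFieldType) (P : {poly F}) :
  P != 0 -> (#|[pred x | root P x]| < size P)%N.
Proof.
move=> P0; rewrite cardE; apply: max_poly_roots => //; last exact: enum_uniq.
by apply/allP => x; rewrite mem_enum.
Qed.

Lemma card_expr_eq_le (F : finFieldType) (n : nat) (z : F) :
  (0 < n)%N -> (#|[pred x : F | x ^+ n == z]| <= n)%N.
Proof.
move=> n0; have := @card_poly_roots F ('X^n - z%:P).
rewrite -size_poly_eq0 size_XnsubC // ltnS => /(_ isT); apply: leq_trans.
apply/subset_leq_card/fintype.subsetP => x.
by rewrite !inE /root !hornerE subr_eq0.
Qed.

(* Every fibre of the n-th power map on the n*m units has at most n elements
   and there are at most m values, so that both bounds are attained. *)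
Lemma card_expr_fibers (F : finFieldType) (n m : nat) :
  (n * m)%N = #|F|.-1 ->
  #|[pred z : F | z ^+ m == 1]| = m /\
  forall z : F, z ^+ m = 1 -> #|[pred x : F | x ^+ n == z]| = n.
Proof.
move=> nm; have F1 := finNzRing_gt1 F.
have : (0 < n * m)%N by rewrite nm -subn1 subn_gt0.
rewrite muln_gt0 => /andP[n0 m0].
pose M := [pred z : F | z ^+ m == 1].
have Mle : (#|M| <= m)%N by exact: card_expr_eq_le.
have unitX (x : F) : x != 0 -> x ^+ #|F|.-1 = 1.
  move=> x0; apply: (mulfI x0).
  by rewrite -exprS prednK ?expf_card ?mulr1 //; exact: ltnW.
have fib z : z \in M -> (#|[pred x : F | x ^+ n == z]| <= n ?= iff
    (#|[pred x : F | x ^+ n == z]| == n))%N.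
  by move=> _; apply/leqifP; case: ltngtP (card_expr_eq_le F n z n0) => //.
have tot : (\sum_(z in M) #|[pred x : F | x ^+ n == z]| = n * m)%N.
  rewrite nm -(cardC1 (0 : F)) -sum1_card.
  rewrite [RHS](partition_big (fun x : F => x ^+ n) (mem M)) /=; last first.
    by move=> x; rewrite !inE => x0; rewrite -exprM nm unitX.
  apply: eq_bigr => z; rewrite !inE => /eqP zm; rewrite -sum1_card.
  apply: eq_bigl => x; rewrite !inE; case: (eqVneq x 0) => //= ->.
  rewrite expr0n eqn0Ngt n0 /=; apply/negP => /eqP z0.
  by move: zm; rewrite -z0 expr0n eqn0Ngt m0 /= => /esym/eqP; rewrite oner_eq0.
have [le1 eq1] := leqif_sum fib.
rewrite tot sum_nat_const mulnC in le1 eq1.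
have cM : #|M| = m by apply/eqP; rewrite eqn_leq Mle -(leq_pmul2r n0).
split=> // z zm; move: eq1; rewrite cM eqxx => /esym/forallP/(_ z).
by rewrite inE zm eqxx /= => /eqP.
Qed.

(** The nonzero solutions are the (m-1)-th roots of unity, and 0 is one more. For m a power of p
    this yields the order of a subfield. *)
Lemma card_expr_fixed (F : finFieldType) (m : nat) :
  (1 < m)%N -> (m.-1 %| #|F|.-1)%N -> #|[pred z : F | z ^+ m == z]| = m.
Proof.
case: m => [//|m] /= m1 /dvdnP[n nm].
have [cM _] := card_expr_fibers F n m (esym nm).
rewrite (cardD1 0) inE expr0n eqxx add1n; congr _.+1.
rewrite -[RHS]cM; apply: eq_card => z; rewrite !inE.
case: (eqVneq z 0) => /= [->|z0].
  by rewrite expr0n eqn0Ngt (m1 : (0 < m)%N) eq_sym oner_eq0.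
by rewrite exprS -{3}[z]mulr1 (inj_eq (mulfI z0)).
Qed.

(** * Traces as sums of Frobenius powers *)

Definition ptrace (F : finFieldType) (m n : nat) (y : F) : F :=
  \sum_(i < n) y ^+ (m ^ i).

Section Trace.
Context (F : finFieldType) (p : nat) (pF : p \in [pchar F]).
Implicit Types (x y c z : F) (a b n : nat).

Let pp : prime p. Proof. exact: pcharf_prime pF. Qed.

Lemma exprD_ppower n x y : (x + y) ^+ (p ^ n) = x ^+ (p ^ n) + y ^+ (p ^ n).
Proof.
apply: exprDn_pchar; rewrite pnatX; apply/orP; left.
by rewrite pnatE // pF.
Qed.

Lemma expr0_ppower n : (0 : F) ^+ (p ^ n) = 0.
Proof. by rewrite expr0n expn_eq0 eqn0Ngt prime_gt0. Qed.

Lemma exprN_ppower n x : (- x) ^+ (p ^ n) = - x ^+ (p ^ n).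
Proof.
by apply/eqP; rewrite -addr_eq0 -exprD_ppower addrC subrr expr0_ppower.
Qed.

Lemma ptraceD a n x y :
  ptrace F (p ^ a) n (x + y) = ptrace F (p ^ a) n x + ptrace F (p ^ a) n y.
Proof.
rewrite /ptrace -big_split /=; apply: eq_bigr => i _.
by rewrite -expnM exprD_ppower.
Qed.

Lemma ptrace0 a n : ptrace F (p ^ a) n 0 = 0.
Proof. by apply: (addrI (ptrace F (p ^ a) n 0)); rewrite -ptraceD !addr0. Qed.

Lemma expr_iter m n x : x ^+ m = x -> x ^+ (m ^ n) = x.
Proof. by move=> xm; elim: n => [|n IH]; rewrite ?expn0 ?expr1 // expnS exprM xm. Qed.

Lemma ptraceZ m n c x : c ^+ m = c -> ptrace F m n (c * x) = c * ptrace F m n x.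
Proof.
move=> cm; rewrite /ptrace big_distrr /=; apply: eq_bigr => i _.
by rewrite exprMn (expr_iter m i c cm).
Qed.

Lemma ptraceSl m n x : ptrace F m n.+1 x = x + ptrace F m n (x ^+ m).
Proof.
rewrite /ptrace big_ord_recl expn0 expr1; congr (_ + _).
by apply: eq_bigr => i _; rewrite -exprM -expnS.
Qed.

Lemma ptraceSr m n x : ptrace F m n.+1 x = ptrace F m n x + x ^+ (m ^ n).
Proof. by rewrite /ptrace big_ord_recr. Qed.

Lemma ptrace_cat m a b x :
  ptrace F m (a + b) x = ptrace F m a x + ptrace F m b (x ^+ (m ^ a)).
Proof.
rewrite /ptrace big_split_ord /=; congr (_ + _).
by apply: eq_bigr => i _; rewrite -exprM -expnD.
Qed.

(** Transitivity of the trace: each exponent below ab is i + a j for unique i < a and j < b, so this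
    is an identity of polynomials in x. *)
Lemma ptrace_mul a b x :
  ptrace F p (a * b) x = ptrace F p a (ptrace F (p ^ a) b x).
Proof.
elim: b x => [|b IH] x.
  rewrite muln0 {1 3}/ptrace !big_ord0.
  by have := ptrace0 1 a; rewrite expn1 => ->.
rewrite mulnS ptrace_cat IH ptraceSl.
by have := ptraceD 1 a; rewrite expn1 => ->.
Qed.

Lemma ptrace_expr a n x b :
  ptrace F (p ^ a) n x ^+ (p ^ b) = ptrace F (p ^ a) n (x ^+ (p ^ b)).
Proof.
elim: n => [|n IH]; last by rewrite !ptraceSr exprD_ppower IH exprAC.
by rewrite /ptrace !big_ord0 expr0_ppower.
Qed.

Lemma ptrace_fixed a n x :
  x ^+ ((p ^ a) ^ n) = x -> ptrace F (p ^ a) n x ^+ (p ^ a) = ptrace F (p ^ a) n x.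
Proof.
(* Frobenius permutes the conjugates cyclically: with x added, the two sides become the two ways of
   splitting off an end term from the sum of n+1 powers. *)
move=> xf; rewrite ptrace_expr; apply: (addrI x).
by rewrite -ptraceSl ptraceSr xf addrC.
Qed.

(* The trace is a polynomial of degree p^(n-1) on a set of p^n elements. *)
Lemma ptrace_nontrivial n : (0 < n)%N ->
  #|[pred z : F | z ^+ (p ^ n) == z]| = (p ^ n)%N ->
  exists2 z : F, z ^+ (p ^ n) = z & ptrace F p n z != 0.
Proof.
case: n => // n _ card_n.
have [/existsP[z /andP[/eqP zf trz]]|] :=
  boolP [exists z : F, (z ^+ (p ^ n.+1) == z) && (ptrace F p n.+1 z != 0)].
  by exists z.
rewrite negb_exists => /forallP tr0.
pose P : {poly F} := \sum_(i < n.+1) 'X^(p ^ i).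
have P0 : P != 0.
  (* Only the term i = 0 contributes to the coefficient of X, which is therefore 1. *)
  apply/eqP => /(congr1 (fun Q : {poly F} => Q`_1)); rewrite coef0 coef_sum.
  rewrite big_ord_recl coefXn expn0 eqxx big1 ?addr0 => [/eqP|i _].
    by rewrite oner_eq0.
  rewrite coefXn eq_sym -[1%N](expn0 p) eqn_exp2l ?prime_gt1 //.
have sP : (size P <= (p ^ n).+1)%N.
  apply: (leq_trans (size_sum _ _ _)); apply/bigmax_leqP => i _.
  by rewrite size_polyXn ltnS leq_exp2l ?prime_gt1 // -ltnS.
exfalso; have := card_poly_roots _ P P0; rewrite ltnNge => /negP; apply.
apply: (leq_trans sP); apply: (@leq_trans (p ^ n.+1)).
  by rewrite ltn_exp2l ?prime_gt1.
rewrite -card_n; apply/subset_leq_card/fintype.subsetP => z; rewrite !inE => zf.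
move: (tr0 z); rewrite zf /= negbK => /eqP tr0z.
apply/rootP; rewrite -[RHS]tr0z horner_sum.
by apply: eq_bigr => i _; rewrite hornerXn.
Qed.

(** The p residues are distinct roots of X^p - X, which has at most p roots, so they exhaust
    them. *)
Lemma prime_subfield_nat x : x ^+ p = x -> exists2 k, (k < p)%N & x = k%:R.
Proof.
move=> xp; have p1 := prime_gt1 pp.
have inj : injective (fun k : 'I_p => k%:R : F).
  move=> i j /eqP; wlog le_ij : i j / (i <= j)%N => [W|].
    by case: (leqP i j) => [/W//|/ltnW/W H]; rewrite eq_sym => /H.
  rewrite eq_sym -subr_eq0 -natrB // -(dvdn_pcharf pF) => dv.
  apply/val_inj/eqP; rewrite /= eqn_leq le_ij /= -subn_eq0.
  apply: contraLR dv; rewrite -lt0n => d0; rewrite gtnNdvd //.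
  by apply: leq_ltn_trans (ltn_ord j); rewrite leq_subr.
pose A := [pred z : F | z ^+ p == z].
have leA : (#|A| <= p)%N.
  have := @card_poly_roots F ('X^p - 'X).
  have sz : size ('X^p - 'X : {poly F}) = p.+1.
    by rewrite size_polyDl ?size_polyXn // size_polyN size_polyX.
  rewrite -size_poly_eq0 sz ltnS => /(_ isT); apply: leq_trans.
  by apply/subset_leq_card/fintype.subsetP => z; rewrite !inE /root !hornerE subr_eq0.
have sub : codom (fun k : 'I_p => k%:R : F) \subset A.
  apply/fintype.subsetP => _ /codomP[k ->]; rewrite inE.
  by apply/eqP; exact: (pFrobenius_aut_nat pF).
have eqA : codom (fun k : 'I_p => k%:R : F) =i A.
  by apply/subset_cardP => //; apply/eqP; rewrite eqn_leq subset_leq_card // card_codom // card_ord.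
have : x \in A by rewrite inE xp.
by rewrite -eqA => /codomP[k ->]; exists (val k); first exact: ltn_ord.
Qed.

End Trace.

(** * Subfields as fixed points of Frobenius, and their additive characters *)

Definition frobfix (F : finFieldType) (m : nat) : {pred F} := [pred z : F | z ^+ m == z].

Lemma frobfixE (F : finFieldType) (m : nat) (z : F) :
  (z \in frobfix F m) = (z ^+ m == z).
Proof. by []. Qed.

Section CharacterSums.
Context (F : finFieldType) (p : nat) (pF : p \in [pchar F]).
Context (C : idomainType) (w : F -> C).
Context (w0 : w 0 = 1).
Context (wD : forall x y : F, x ^+ p = x -> y ^+ p = y -> w (x + y) = w x * w y).
Context (w1 : w 1 != 1).

Let pp : prime p. Proof. exact: pcharf_prime pF. Qed.

Lemma frobfix0 n : 0 \in frobfix F (p ^ n).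
Proof. by rewrite frobfixE expr0_ppower. Qed.

Lemma frobfixD n x y : x \in frobfix F (p ^ n) -> y \in frobfix F (p ^ n) ->
  x + y \in frobfix F (p ^ n).
Proof. by rewrite !frobfixE exprD_ppower // => /eqP -> /eqP ->. Qed.

Lemma frobfixN n x : (- x \in frobfix F (p ^ n)) = (x \in frobfix F (p ^ n)).
Proof. by rewrite !frobfixE exprN_ppower // eqr_opp. Qed.

Lemma frobfixM m x y : x \in frobfix F m -> y \in frobfix F m -> x * y \in frobfix F m.
Proof. by rewrite !frobfixE exprMn => /eqP -> /eqP ->. Qed.

Lemma frobfixV m x : (x^-1 \in frobfix F m) = (x \in frobfix F m).
Proof. by rewrite !frobfixE exprVn (inj_eq invr_inj). Qed.

Lemma frobfixX m x n : x \in frobfix F m -> x ^+ n \in frobfix F m.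
Proof. by rewrite !frobfixE exprAC => /eqP ->. Qed.

Lemma frobfix_expn m n x : x \in frobfix F m -> x \in frobfix F (m ^ n).
Proof. by rewrite !frobfixE => /eqP /expr_iter ->. Qed.

(** The canonical additive character of the subfield of order p^n. Since [w] is additive on the
    prime field only, the argument must lie in that subfield for its trace to land there. *)
Definition addchar (n : nat) (z : F) : C := w (ptrace F p n z).

Lemma ptrace_prime_fixed n x : x \in frobfix F (p ^ n) -> ptrace F p n x ^+ p = ptrace F p n x.
Proof.
move/eqP => xf; have := @ptrace_fixed F p pF 1 n x.
by rewrite expn1 => ->.
Qed.

Lemma addchar0 n : addchar n 0 = 1.
Proof. by rewrite /addchar; have := ptrace0 F p pF 1 n; rewrite expn1 => ->. Qed.

Lemma addcharD n x y : x \in frobfix F (p ^ n) -> y \in frobfix F (p ^ n) ->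
  addchar n (x + y) = addchar n x * addchar n y.
Proof.
move=> xf yf; rewrite /addchar.
have := ptraceD F p pF 1 n x y; rewrite expn1 => ->.
by rewrite wD // ptrace_prime_fixed.
Qed.

Lemma addchar_orthogonality n u : (0 < n)%N -> ((p ^ n).-1 %| #|F|.-1)%N ->
  u \in frobfix F (p ^ n) ->
  \sum_(y in frobfix F (p ^ n)) addchar n (y * u) = (p ^ n)%:R * (u == 0)%:R.
Proof.
move=> n0 dv uf.
have cardk : #|frobfix F (p ^ n)| = (p ^ n)%N.
  by apply: card_expr_fixed => //; rewrite -(exp1n n) ltn_exp2r // prime_gt1.
case: eqVneq => [-> | u0].
  under eq_bigr => y _ do rewrite mulr0 addchar0.
  by rewrite sumr_const cardk mulr1.
have [z zf trz] := ptrace_nontrivial F p pF n n0 cardk.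
have {}zf : z \in frobfix F (p ^ n) by rewrite frobfixE zf.
pose v := ptrace F p n z.
have vp : v ^+ p = v by exact: ptrace_prime_fixed.
have vf : v \in frobfix F (p ^ n) by apply: frobfix_expn; rewrite frobfixE vp.
(* The trace v of z is a nonzero element of the prime field, so v^-1 z has trace 1. Translation by
   z' then permutes the subfield and multiplies the sum by [w 1], which differs from 1. *)
pose z' := v^-1 * z / u.
have z'f : z' \in frobfix F (p ^ n) by rewrite !frobfixM ?frobfixV.
have Ez' : addchar n (z' * u) = w 1.
  rewrite /z' divfK // /addchar ptraceZ ?mulVf //.
  by rewrite exprVn vp.
rewrite mulr0; set S := (LHS).
have : S = w 1 * S.
  rewrite {1}/S (reindex_inj (addrI z')) /= mulr_sumr.
  apply: eq_big => [y|y yf].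
    apply/idP/idP => [H|]; last exact: frobfixD.
    by rewrite -[y](addKr z') frobfixD ?frobfixN.
  have yf' : y \in frobfix F (p ^ n) by rewrite -[y](addKr z') frobfixD ?frobfixN.
  by rewrite mulrDl addcharD ?Ez' //; exact: frobfixM.
move/eqP; rewrite -subr_eq0 -{1}[S]mul1r -mulrBl mulf_eq0 subr_eq0 eq_sym.
by rewrite (negbTE w1) => /eqP.
Qed.

(** * Character sums over the levels of the Hermitian form *)

Section QuadraticForm.
Context (t s : nat) (t0 : (0 < t)%N) (s0 : (0 < s)%N).
Context (podd : odd p).
Context (cardF : #|F| = ((p ^ (t * s)) ^ 2)%N).

Let r := (p ^ t)%N.
Let q := (p ^ (t * s))%N.
Local Notation k := (frobfix F (p ^ t)).
Local Notation E := (frobfix F (p ^ (t * s))).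
Local Notation TrQR := (ptrace F (p ^ t) s).
Local Notation Psi := (addchar t).
Local Notation PsiE := (addchar (t * s)).

Definition qform (x : F) : F := TrQR (x ^+ (p ^ (t * s)).+1).
Definition abschar (x : F) : C := addchar (2 * (t * s)) x.

Let q1 : (1 < q)%N.
Proof. by rewrite /q -(exp1n (t * s)) ltn_exp2r ?prime_gt1 // muln_gt0 t0. Qed.

Let cardk : #|k| = r.
Proof.
apply: card_expr_fixed; first by rewrite -(exp1n t) ltn_exp2r // prime_gt1.
by rewrite cardF expnM -expnM dvdn_pred_predX.
Qed.

Let orth_k u : u \in k -> \sum_(y in k) Psi (y * u) = r%:R * (u == 0)%:R.
Proof.
apply: addchar_orthogonality => //.
by rewrite cardF expnM -expnM dvdn_pred_predX.
Qed.

Let orth_E u : u \in E -> \sum_(y in E) PsiE (y * u) = q%:R * (u == 0)%:R.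
Proof.
apply: addchar_orthogonality => //; first by rewrite muln_gt0 t0.
by rewrite cardF dvdn_pred_predX.
Qed.

Let expfq2 (x : F) : (x ^+ q) ^+ q = x.
Proof. by rewrite -exprM -[(q * q)%N]/(q ^ 2)%N -cardF expf_card. Qed.

Let orth_F b : \sum_x abschar (b * x) = (q ^ 2)%:R * (b == 0)%:R.
Proof.
have q2 : (p ^ (2 * (t * s)) = q ^ 2)%N by rewrite mulnC expnM.
have fT x : x \in frobfix F (p ^ (2 * (t * s))).
  by rewrite frobfixE q2 -cardF expf_card.
have n0 : (0 < 2 * (t * s))%N by rewrite !muln_gt0 t0.
have dv : ((p ^ (2 * (t * s))).-1 %| #|F|.-1)%N by rewrite cardF q2.
rewrite -q2 -(addchar_orthogonality _ _ n0 dv (fT b)).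
by apply: eq_big => [x|x _]; rewrite ?fT // mulrC.
Qed.

Let trE (x : F) : x + x ^+ q \in E.
Proof. by rewrite frobfixE exprD_ppower // expfq2 addrC. Qed.

Let normE (x : F) : x ^+ q.+1 \in E.
Proof. by rewrite frobfixE exprS exprMn expfq2 mulrC. Qed.

Let kE x : x \in k -> x \in E.
Proof. by rewrite expnM; exact: frobfix_expn. Qed.

(** Transitivity of the trace through E, over which the trace of x is x + x^q; every sum can then be
    computed with [PsiE]. *)
Lemma abscharE x : abschar x = PsiE (x + x ^+ q).
Proof.
by rewrite /abschar /addchar mulnC ptrace_mul // !ptraceSl [ptrace F _ 0 _]big_ord0 addr0.
Qed.

Let Psi_trace x : Psi (TrQR x) = PsiE x.
Proof. by rewrite /addchar ptrace_mul. Qed.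

Lemma qform_fixed x : qform x \in k.
Proof.
rewrite frobfixE /qform; apply/eqP/ptrace_fixed => //.
by rewrite -expnM; apply/eqP; exact: normE.
Qed.

Let Psi_qform y x : y \in k -> Psi (y * qform x) = PsiE (y * x ^+ q.+1).
Proof.
by move=> yk; rewrite /qform -ptraceZ ?Psi_trace //; apply/eqP.
Qed.

(** The norm x^(q+1) maps units onto the (q-1)-th roots of unity, which are the units of E, and
    (q+1)(q-1) = q^2 - 1 makes all fibres equal. *)
Lemma card_norm_fiber z : z \in E ->
  #|[pred x : F | x ^+ q.+1 == z]| = if z == 0 then 1%N else q.+1.
Proof.
move=> zE; case: eqVneq => [->|z0].
  rewrite -(card1 (0 : F)); apply: eq_card => x; rewrite !inE.
  by rewrite expf_eq0.
have qq : (q.+1 * q.-1)%N = #|F|.-1.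
  by rewrite cardF mulnC; have := subn_sqr q 1; rewrite exp1n !subn1 addn1 => ->.
apply: (card_expr_fibers F _ _ qq).2.
apply: (mulfI z0); rewrite -exprS prednK; last exact: ltnW.
by rewrite mulr1; apply/eqP.
Qed.

Lemma norm_sum y : y \in E -> y != 0 -> \sum_x PsiE (y * x ^+ q.+1) = - q%:R.
Proof.
move=> yE y0.
rewrite (partition_big (fun x => x ^+ q.+1) (mem E)) /=; last by move=> x _; exact: normE.
(* The fibre over 0 has weight 1 = (q+1) - q: the constant weight q+1 cancels by orthogonality, and
   the correction at z = 0 leaves -q. *)
transitivity (\sum_(z in E) (q.+1%:R * PsiE (z * y) - q%:R * ((z == 0)%:R * PsiE (z * y)))).
  apply: eq_bigr => z zE.
  under eq_bigr => x /eqP -> do rewrite mulrC.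
  rewrite sumr_const card_norm_fiber //; case: eqP => _.
    by rewrite mulr1n /= mul1r -[q.+1%:R]natr1 mulrDl mul1r addrAC subrr add0r.
  by rewrite mul0r mulr0 subr0 mulr_natl.
rewrite sumrB -!mulr_sumr orth_E // (negbTE y0) !mulr0 sub0r.
rewrite (bigD1 0) ?frobfix0 //= eqxx mul1r mul0r addchar0 big1 ?addr0 ?mulr1 //.
by move=> z /andP[_ /negbTE ->]; rewrite mul0r.
Qed.

(* Completion of the square: y N(x) + b x + (b x)^q = y N(x + b^q / y) - N(b) / y. *)
Lemma hermitian_sum y b : y \in k -> y != 0 ->
  \sum_x Psi (y * qform x) * abschar (b * x) = - q%:R * Psi (- (qform b / y)).
Proof.
move=> yk y0; have yE := kE _ yk.
have step x : Psi (y * qform x) * abschar (b * x) =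
    PsiE (y * (x + b ^+ q / y) ^+ q.+1) * Psi (- (qform b / y)).
  rewrite Psi_qform // abscharE -addcharD ?trE ?frobfixM ?normE //.
  rewrite [qform b / y]mulrC -mulNr Psi_qform ?frobfixN ?frobfixV //.
  rewrite -addcharD ?frobfixM ?normE ?frobfixN ?frobfixV //.
  congr (addchar _ _); rewrite !exprS exprD_ppower // !exprMn.
  rewrite exprVn (eqP (yE : y ^+ q == y)) (expfq2 b).
  by field.
rewrite (eq_bigr _ (fun x _ => step x)) -mulr_suml.
congr (_ * _).
have -> : \sum_x PsiE (y * (x + b ^+ q / y) ^+ q.+1) = \sum_x PsiE (y * x ^+ q.+1).
  by rewrite [RHS](reindex_inj (addIr (b ^+ q / y))).
exact: norm_sum.
Qed.

(** Orthogonality over k detects Q(x) = c. The term y = 0 is the complete sum over F, and each y <>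
    0 is evaluated by [hermitian_sum]. *)
Lemma level_sum b c : c \in k ->
  r%:R * \sum_(x | qform x == c) abschar (b * x) =
  (q ^ 2)%:R * (b == 0)%:R -
  q%:R * \sum_(y in k | y != 0) Psi (- (y * c) - qform b / y).
Proof.
move=> ck.
transitivity (\sum_x \sum_(y in k) Psi (y * (qform x - c)) * abschar (b * x)).
  rewrite big_mkcond mulr_sumr; apply: eq_bigr => x _ /=.
  rewrite -mulr_suml orth_k ?frobfixD ?frobfixN ?qform_fixed // subr_eq0.
  by case: eqP => _; rewrite ?mulr1 // !mulr0 mul0r.
rewrite exchange_big /= (bigD1 0) ?frobfix0 //=; congr (_ + _).
  rewrite -orth_F; apply: eq_bigr => x _.
  by rewrite mul0r addchar0 mul1r.
rewrite mulr_sumr -sumrN; apply: eq_bigr => y /andP[yk y0].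
transitivity (Psi (- (y * c)) * \sum_x Psi (y * qform x) * abschar (b * x)).
  rewrite mulr_sumr; apply: eq_bigr => x _.
  rewrite mulrBr addrC addcharD ?frobfixN ?frobfixM ?qform_fixed //.
  by rewrite mulrA.
rewrite hermitian_sum // addcharD ?frobfixN ?frobfixM ?qform_fixed ?frobfixV //.
by ring.
Qed.

(** For c in k this is 1 + eta(c), so the value 0 singles out the nonsquares. *)
Definition sqrt_card (c : F) : nat := #|[pred z in k | z ^+ 2 == c]|.

Let two_neq0 : (2%:R : F) != 0.
Proof.
rewrite -(dvdn_pcharf pF); apply/negP => /dvdn_leq -/(_ isT) p2.
by move: podd (prime_gt1 pp); case: p p2 => [|[|[|]]].
Qed.

Lemma sqrt_card_eq c : c \in k ->
  sqrt_card c = if c == 0 then 1%N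
    else if [exists z : F, (z ^+ r == z) && (z ^+ 2 == c)] then 2%N else 0%N.
Proof.
move=> ck; case: eqVneq => [->|c0].
  rewrite -(card1 (0 : F)); apply: eq_card => z; rewrite !inE expf_eq0 /=.
  by have [->|_] := eqVneq z 0; rewrite ?andbF // expr0_ppower // eqxx.
case: existsP => [[z /andP[zk /eqP zc]]|nex]; last first.
  apply: eq_card0 => z; rewrite !inE; apply/negP => /andP[zk zc].
  by apply: nex; exists z; rewrite zk zc.
have z0 : z != 0 by apply: contraNneq c0 => z0; rewrite -zc z0 expr0n.
(* In odd characteristic the two roots z and -z of a nonzero square are distinct. *)
have zN : z != - z by rewrite -subr_eq0 opprK -mulr2n -mulr_natl mulf_neq0.
transitivity #|pred2 z (- z)|; last by rewrite card2 zN.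
apply: eq_card => x; rewrite !inE -zc eqf_sqr.
have [->|_] := eqVneq x z; first by rewrite andbT.
have [->|_] := eqVneq x (- z); last by rewrite andbF.
by rewrite andbT -frobfixE frobfixN.
Qed.

Lemma sum_frobfixV (f : F -> C) :
  \sum_(y in k | y != 0) f y^-1 = \sum_(y in k | y != 0) f y.
Proof.
rewrite [RHS](reindex_inj invr_inj) /=.
by apply: eq_bigl => y; rewrite frobfixV invr_eq0.
Qed.

Lemma sum_frobfix_neq0 u : u \in k ->
  \sum_(y in k | y != 0) Psi (- (y * u)) = r%:R * (u == 0)%:R - 1.
Proof.
move=> uk; have := orth_k (- u); rewrite frobfixN oppr_eq0 => /(_ uk) <-.
rewrite [in RHS](bigD1 0) ?frobfix0 //= mul0r addchar0 addrC addrK.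
by apply: eq_bigr => y _; rewrite mulrN.
Qed.

(* 2 [eta(c) = -1] = 2 - #{z in F_r : z^2 = c} - [c = 0] reduces the sum over
   the nonsquare levels to sums over the levels z^2 and 0. *)
Lemma nonsquare_level_sum b :
  2 * r%:R * \sum_(x | sqrt_card (qform x) == 0%N) abschar (b * x) =
  (r%:R - 1) * (q ^ 2)%:R * (b == 0)%:R +
  q%:R * (r%:R * (sqrt_card (- qform b))%:R - r%:R + r%:R * (qform b == 0)%:R - 1).
Proof.
set beta := qform b; have bk : beta \in k by exact: qform_fixed.
have step : 2 * \sum_(x | sqrt_card (qform x) == 0%N) abschar (b * x) =
    2 * \sum_x abschar (b * x)
    - \sum_(z in k) \sum_(x | qform x == z ^+ 2) abschar (b * x)
    - \sum_(x | qform x == 0) abschar (b * x).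
  have -> : \sum_(z in k) \sum_(x | qform x == z ^+ 2) abschar (b * x) =
      \sum_x \sum_(z in k) (if qform x == z ^+ 2 then abschar (b * x) else 0).
    by rewrite exchange_big; apply: eq_bigr => z _; rewrite big_mkcond.
  rewrite [in LHS]big_mkcond [\sum_(x | qform x == 0) _]big_mkcond.
  rewrite !mulr_sumr -!sumrB; apply: eq_bigr => x _.
  have -> : \sum_(z in k) (if qform x == z ^+ 2 then abschar (b * x) else 0)
      = (sqrt_card (qform x))%:R * abschar (b * x).
    rewrite -big_mkcondr /= sumr_const mulr_natl; congr (_ *+ _).
    by apply: eq_card => z; congr (_ && _); exact: eq_sym.
  rewrite sqrt_card_eq ?qform_fixed //; have [_|_] := eqVneq (qform x) 0 => /=.
    by ring.
  by case: existsP => _ /=; ring.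
have level0 := level_sum b 0 (frobfix0 _).
have level2 z : z \in k -> _ := fun zk => level_sum b (z ^+ 2) (frobfixX _ _ 2 zk).
have sum2 : r%:R * \sum_(z in k) \sum_(x | qform x == z ^+ 2) abschar (b * x) =
    \sum_(z in k) ((q ^ 2)%:R * (b == 0)%:R -
      q%:R * \sum_(y in k | y != 0) Psi (- (y * z ^+ 2) - beta / y)).
  by rewrite mulr_sumr; exact: eq_bigr.
rewrite -mulrA mulrCA step !mulrBr sum2 level0 sumrB.
rewrite sumr_const cardk -mulr_sumr orth_F.
have -> : \sum_(y in k | y != 0) Psi (- (y * 0) - beta / y) = r%:R * (beta == 0)%:R - 1.
  rewrite -sum_frobfix_neq0 // -[RHS]sum_frobfixV.
  by apply: eq_bigr => y _; rewrite mulr0 oppr0 sub0r mulrC.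
have -> : \sum_(z in k) \sum_(y in k | y != 0) Psi (- (y * z ^+ 2) - beta / y)
   = r%:R * (sqrt_card (- beta))%:R - r%:R.
  rewrite exchange_big /=.
  (* Replacing z by z/y turns y z^2 + beta/y into (z^2 + beta)/y. Summing over y first then detects
     z^2 = -beta. *)
  transitivity (\sum_(y in k | y != 0) \sum_(z in k) Psi (- (y^-1 * (z ^+ 2 + beta)))).
    apply: eq_bigr => y /andP[yk y0].
    rewrite (reindex_inj (mulfI (invr_neq0 y0))) /=; apply: eq_big => z.
      apply/idP/idP => [H|zk]; last by rewrite frobfixM ?frobfixV.
      by rewrite -[z](mulVKf y0) frobfixM.
    by move=> _; congr (addchar _ _); field.
  rewrite exchange_big /=.
  transitivity (\sum_(z in k) (r%:R * (z ^+ 2 == - beta)%:R - 1 : C)).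
    apply: eq_bigr => z zk.
    rewrite (sum_frobfixV (fun y => Psi (- (y * (z ^+ 2 + beta))))) sum_frobfix_neq0.
      by rewrite addr_eq0.
    by rewrite frobfixD ?frobfixX.
  rewrite sumrB sumr_const cardk -mulr_sumr; congr (_ * _ - _).
  by rewrite -natr_sum -big_mkcondr sum1_card.
rewrite natrX -mulr_natl; ring.
Qed.

End QuadraticForm.
End CharacterSums.

(** * The complex character of the prime field *)

Section Zeta.
Context (R : realType) (p : nat) (pp : prime p) (podd : odd p).

Lemma complex_deMoivre (x : R) (n : nat) :
  (Complex (cos x) (sin x)) ^+ n = Complex (cos (n%:R * x)) (sin (n%:R * x)).
Proof.
elim: n => [|n IH]; first by rewrite expr0 mul0r cos0 sin0.
rewrite exprS IH -natr1 addrC mulrDl mul1r cosD sinD.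
by congr Complex; rewrite addrC.
Qed.

Let p3 : (3 <= p)%N.
Proof. by move: podd (prime_gt1 pp); case: p => [|[|[|]]]. Qed.

Lemma zetap_expp : zetap p R ^+ p = 1.
Proof.
rewrite /zetap complex_deMoivre mulrC divfK ?pnatr_eq0; last by rewrite -lt0n prime_gt0.
by rewrite mulr_natl cos2pi sin2pi.
Qed.

(** As p >= 3, the angle 2 pi / p lies strictly between 0 and pi, so the imaginary part is
    positive. *)
Lemma zetap_neq1 : zetap p R != 1.
Proof.
apply/eqP => /(congr1 (@complex.Im R)) /= /eqP; apply/negP.
rewrite gt_eqF // sin_gt0_pi //.
have p0 : (0 : R) < p%:R by rewrite ltr0n prime_gt0.
rewrite divr_gt0 ?mulr_gt0 ?pi_gt0 //= ltr_pdivrMr // mulrC ltr_pM2l ?pi_gt0 //.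
by rewrite ltr_nat.
Qed.

Lemma zetap_conj : zetap p R * conjc (zetap p R) = 1.
Proof.
rewrite /zetap; set x := 2 * _ / _.
have := cos2Dsin2 x; rewrite !expr2 => H.
by congr Complex; rewrite /= ?mulrN ?opprK // [sin x * _]mulrC addNr.
Qed.

Lemma zetap_expr_conj n : zetap p R ^+ n * conjc (zetap p R ^+ n) = 1.
Proof. by rewrite rmorphXn -exprMn zetap_conj expr1n. Qed.

Context (F : finFieldType) (pF : p \in [pchar F]).

(** Equality in F means congruence modulo p, the order of the root of unity; this makes the exponent
    chosen by [primeFieldNat] immaterial. *)
Lemma zetap_expr_natr (a b : nat) :
  (a%:R : F) = b%:R -> zetap p R ^+ a = zetap p R ^+ b.
Proof.
wlog le_ab : a b / (a <= b)%N => [W|].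
  by case: (leqP a b) => [/W//|/ltnW/W H /esym /H].
move=> /esym/eqP; rewrite -subr_eq0 -natrB // -(dvdn_pcharf pF) => /dvdnP[c E].
by rewrite -(subnK le_ab) E exprD mulnC exprM zetap_expp expr1n mul1r.
Qed.

(** Outside the prime field [primeFieldNat] defaults to 0, so the value there is 1. *)
Definition primechar (u : F) : R[i] := zetap p R ^+ primeFieldNat p u.

Lemma primechar_nat n : primechar n%:R = zetap p R ^+ n.
Proof.
rewrite /primechar /primeFieldNat; case: pickP => [k /eqP /zetap_expr_natr //|nk].
have := nk (Ordinal (ltn_pmod n (prime_gt0 pp))) => /eqP[] /=.
by rewrite [in RHS](divn_eq n p) natrD natrM (pcharf0 pF) mulr0 add0r.
Qed.

Lemma primecharD (x y : F) : x ^+ p = x -> y ^+ p = y ->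
  primechar (x + y) = primechar x * primechar y.
Proof.
move=> /(prime_subfield_nat F p pF)[a _ ->] /(prime_subfield_nat F p pF)[b _ ->].
by rewrite -natrD !primechar_nat exprD.
Qed.

Lemma primechar0 : primechar 0 = 1.
Proof. by have := primechar_nat 0; rewrite expr0. Qed.

Lemma primechar1 : primechar 1 != 1.
Proof. by have := primechar_nat 1; rewrite expr1 => ->; exact: zetap_neq1. Qed.

End Zeta.

(** * Size of D and correlations of the codewords *)

Lemma normalized_sum (R : realFieldType) (r q K S e : R) :
  3 <= r -> 1 <= q -> 2 * r * K = (r - 1) * (q * (q + 1)) -> 2 * r * S = q * e ->
  K^-1 * S = e / ((r - 1) * (q + 1)).
Proof.
move=> r3 q1 KE SE.
have r0 : r != 0 by rewrite gt_eqF; lra.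
have r1 : r - 1 != 0 by rewrite gt_eqF; lra.
have q0 : q != 0 by rewrite gt_eqF; lra.
have q2 : q + 1 != 0 by rewrite gt_eqF; lra.
have -> : K = (r - 1) * (q * (q + 1)) / (2 * r) by rewrite -KE; field.
have -> : S = q * e / (2 * r) by rewrite -SE; field.
by field; rewrite r0 r1 q0 q2.
Qed.

Section Correlation.
Context (R : realType) (F : finFieldType) (p t s : nat).
Context (pp : prime p) (podd : odd p) (t0 : (0 < t)%N) (s0 : (0 < s)%N).
Context (cardF : #|F| = ((p ^ (t * s)) ^ 2)%N).

Local Notation r := (p ^ t)%N.
Local Notation q := (p ^ (t * s))%N.
Local Notation D := (Dset F p t s).
Local Notation K := (KK F p t s).
Local Notation w := (primechar R p F).
Local Notation psi := (abschar F p R[i] w t s).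
Local Notation nu := (sqrt_card F p t).
Local Notation Q := (qform F p t s).

Let pF : p \in [pchar F].
Proof. by apply: (@card_finPcharP F p (t * s * 2)) => //; rewrite cardF -expnM. Qed.

Let r3 : (3 <= r)%N.
Proof.
apply: (@leq_trans p); last by rewrite -{1}(expn1 p) leq_pexp2l // prime_gt0.
by move: podd (prime_gt1 pp); case: p => [|[|[|]]].
Qed.

Let Q_fixed x : Q x \in frobfix F r.
Proof. exact: qform_fixed. Qed.

Lemma in_Dset x : (x \in D) = (nu (Q x) == 0%N).
Proof.
rewrite inE sqrt_card_eq // /etaQ.
have -> : trQR p t s (x ^+ TT p t s) = Q x.
  by rewrite /trQR /qform /TT /qq /rr addn1 -expnM.
by have [_|_] := eqVneq (Q x) 0 => //; case: existsP.
Qed.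

Lemma abschar_D x y : psi (x + y) = psi x * psi y.
Proof.
have fT z : z \in frobfix F (p ^ (2 * (t * s))).
  by rewrite frobfixE mulnC expnM -cardF expf_card.
by apply: addcharD => //; exact: primecharD.
Qed.

(** The two factors 1/sqrt K combine to 1/K, and the conjugate of a power of zeta is its inverse, so
    the product of characters depends on a - a' only. *)
Lemma corrE a a' :
  corr p t s R a a' = (Complex (K%:R)^-1 0) * \sum_(x in D) psi ((a - a') * x).
Proof.
rewrite /corr mulr_sumr; apply: eq_bigr => x _.
rewrite /cw rmorphM /= mulrACA; congr (_ * _).
  congr Complex; rewrite /= ?oppr0 ?mulr0 ?mul0r ?addr0 ?subr0 //.
  by rewrite -invfM -expr2 sqr_sqrtr.
have -> : psi ((a - a') * x) = psi (a * x) * conjc (psi (a' * x)).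
  have -> : a * x = (a - a') * x + a' * x by rewrite -mulrDl subrK.
  rewrite abschar_D -mulrA.
  by rewrite /abschar /addchar zetap_expr_conj mulr1.
by [].
Qed.

Let main b :
  2 * r%:R * \sum_(x in D) psi (b * x) =
  (r%:R - 1) * (q ^ 2)%:R * (b == 0)%:R +
  q%:R * (r%:R * (nu (- Q b))%:R - r%:R + r%:R * (Q b == 0)%:R - 1).
Proof.
rewrite -(@nonsquare_level_sum F p pF _ w) //; first last.
- exact: primechar1.
- exact: primecharD.
- exact: primechar0.
by congr (_ * _); apply: eq_bigl => x; rewrite in_Dset.
Qed.

(** At b = 0 every summand is 1, so the sum counts D. There nu = 1 and the bracket equals r - 1,
    giving (r-1) q^2 + q (r-1). *)
Lemma card_Dset : (2 * r * K)%N = ((r - 1) * (q * (q + 1)))%N.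
Proof.
apply/eqP; rewrite -(eqr_nat R[i]); have := main 0.
have Q0 : Q 0 = 0 by rewrite /qform expr0n ptrace0.
rewrite Q0 oppr0 sqrt_card_eq ?eqxx //; last by exact: frobfix0.
under eq_bigr => x _ do rewrite mul0r /abschar addchar0 ?primechar0 //.
rewrite sumr_const -/K => H; apply/eqP.
rewrite !natrM natrD natrB ?(leq_trans _ r3) // H natrX /=; ring.
Qed.

Lemma normc_real (x : R) : Normc.normc (Complex x 0) = `|x|.
Proof. by rewrite /= expr0n addr0 sqrtr_sqr. Qed.

Lemma normc_corr (a a' : F) : a' != a ->
  Normc.normc (corr p t s R a a') = 1 / (q%:R + 1) \/
  Normc.normc (corr p t s R a a') = (r%:R + 1) / ((r%:R - 1) * (q%:R + 1)).
Proof.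
move=> aa'; set b := a - a'.
have b0 : b == 0 = false by rewrite subr_eq0 eq_sym; apply/negbTE.
have := main b; rewrite b0 mulr0 add0r corrE -/b.
set S := \sum_(x in D) _ => E.
pose e : R := r%:R * (nu (- Q b))%:R - r%:R + r%:R * (Q b == 0)%:R - 1.
have rR : (3 : R) <= r%:R by rewrite ler_nat.
have qR : (1 : R) <= q%:R by rewrite ler1n expn_gt0 prime_gt0.
(* If Q(b) = 0 then nu = 1 and e = r - 1. Otherwise nu = 2 gives e = r - 1, and nu = 0 gives e = -(r
   + 1). *)
have e_val : `|e| = r%:R - 1 \/ `|e| = r%:R + 1.
  rewrite /e sqrt_card_eq ?frobfixN // oppr_eq0.
  have [_|_] := eqVneq (Q b) 0 => /=.
    by left; rewrite ger0_norm; lra.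
  case: existsP => _; first by left; rewrite ger0_norm; lra.
  by right; rewrite ler0_norm; lra.
have nS : 2 * r%:R * Normc.normc S = q%:R * `|e|.
  have -> : 2 * r%:R * Normc.normc S = Normc.normc (2 * r%:R * S).
    rewrite Normc.normcM; congr (_ * _).
    have -> : (2 * r%:R : R[i]) = Complex (2 * r%:R) 0.
      by rewrite -[RHS]/((2 * r%:R)%:C)%C rmorphM !rmorph_nat.
    by rewrite normc_real ger0_norm // mulr_ge0.
  have -> : 2 * r%:R * S = Complex (q%:R * e) 0.
    rewrite E -[RHS]/((q%:R * e)%:C)%C /e.
    by rewrite !(rmorphM, rmorphB, rmorphD, rmorph_nat, rmorph1).
  by rewrite normc_real normrM normr_nat.
have KR : 2 * r%:R * K%:R = (r%:R - 1) * (q%:R * (q%:R + 1)) :> R.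
  have := congr1 (fun n => n%:R : R) card_Dset.
  by rewrite !natrM natrD natrB // (leq_trans _ r3).
have -> : Normc.normc (Complex (K%:R)^-1 0 * S) = `|e| / ((r%:R - 1) * (q%:R + 1)).
  rewrite Normc.normcM normc_real ger0_norm ?invr_ge0 //.
  exact: normalized_sum KR nS.
clear E.
have [r1 q0] : r%:R - 1 != 0 :> R /\ q%:R + 1 != 0 :> R by split; rewrite gt_eqF; lra.
by case: e_val => ->; [left; rewrite invfM mulrA divff|right].
Qed.

(** Any pair of distinct codewords will do, since both possible correlations are at least 1/(q+1);
    the pair 0, 1 is taken. *)
Lemma Imax_ge : 1 / (q%:R + 1) <= Imax F p t s R.
Proof.
have rR : (3 : R) <= r%:R by rewrite ler_nat.
have qR : (1 : R) <= q%:R by rewrite ler1n expn_gt0 prime_gt0.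
apply: (bigmax_sup (0 : F)) => //; apply: (bigmax_sup (1 : F)); first exact: oner_neq0.
have [->//|->] := normc_corr (0 : F) 1 (oner_neq0 _).
by rewrite invfM mulrA ler_wpM2r ?invr_ge0 ?ler_pdivlMr; lra.
Qed.

Lemma Imax_le : Imax F p t s R <= (r%:R + 1) / ((r%:R - 1) * (q%:R + 1)).
Proof.
have rR : (3 : R) <= r%:R by rewrite ler_nat.
have qR : (1 : R) <= q%:R by rewrite ler1n expn_gt0 prime_gt0.
(* Both maxima start from 0, so the bound itself must be nonnegative. *)
have B0 : 0 <= (r%:R + 1) / ((r%:R - 1) * (q%:R + 1)) :> R.
  by rewrite divr_ge0 ?mulr_ge0; lra.
apply/bigmax_le => // a _; apply/bigmax_le => // a' aa'.
have [->|->//] := normc_corr a a' aa'.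
by rewrite invfM [leRHS]mulrA ler_wpM2r ?invr_ge0 ?ler_pdivlMr; lra.
Qed.

End Correlation.

(** * Comparison with the Welch bound and the limit *)

Lemma welch_ratio_bounds (R : rcfType) (r q K I : R) :
  3 <= r -> r <= q -> 2 * r * K = (r - 1) * (q * (q + 1)) ->
  1 / (q + 1) <= I -> I <= (r + 1) / ((r - 1) * (q + 1)) ->
  (r - 1) / (r + 2) <= I / Num.sqrt ((q ^+ 2 - K) / ((q ^+ 2 - 1) * K)) <= (r + 1) / (r - 1).
Proof.
move=> r3 rq KE Ige Ile.
have r0 : 0 < r by lra.
have r1 : 0 < r - 1 by lra.
have q0 : 0 < q by lra.
have q1 : 0 < q - 1 by lra.
have q2 : 0 < q + 1 by lra.
(* This is (q+1)^2 times the square of the Welch bound, with K eliminated; it equals (r+1)/(r-1) +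
   2/((q-1)(r-1)). *)
pose c := ((q - 1) * (r + 1) + 2) / ((q - 1) * (r - 1)).
have E : (q ^+ 2 - K) / ((q ^+ 2 - 1) * K) = c / (q + 1) ^+ 2.
  have -> : K = (r - 1) * (q * (q + 1)) / (2 * r) by rewrite -KE; field; rewrite gt_eqF.
  have -> : q ^+ 2 - 1 = (q - 1) * (q + 1) by ring.
  by rewrite /c; field; rewrite !gt_eqF.
have c_ge1 : 1 <= c.
  by rewrite /c ler_pdivlMr ?mulr_gt0 // mul1r; nra.
(* Since q - 1 >= 2, c is at most (r+2)/(r-1). That quotient is at least 1, hence at most its
   square, which gives a bound on sqrt c without radicals. *)
have c_le : c <= ((r + 2) / (r - 1)) ^+ 2.
  apply: (@le_trans _ _ ((r + 2) / (r - 1))).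
    rewrite /c invfM mulrA ler_wpM2r ?invr_ge0 ?(ltW r1) // ler_pdivrMr //; nra.
  by rewrite expr2 ler_peMl ?ler_pdivlMr ?divr_ge0 //; lra.
have -> : Num.sqrt ((q ^+ 2 - K) / ((q ^+ 2 - 1) * K)) = Num.sqrt c / (q + 1).
  by rewrite E sqrtrM ?sqrtrV ?sqrtr_sqr ?ger0_norm //; nra.
have s1 : 1 <= Num.sqrt c by rewrite -sqrtr1 ler_sqrt //; lra.
have s2 : Num.sqrt c <= (r + 2) / (r - 1).
  have x0 : 0 <= (r + 2) / (r - 1) by rewrite divr_ge0; lra.
  by rewrite -[leRHS](ger0_norm x0) -sqrtr_sqr ler_wsqrtr.
have s0 : 0 < Num.sqrt c by lra.
have -> : I / (Num.sqrt c / (q + 1)) = I * (q + 1) / Num.sqrt c by field; rewrite !gt_eqF.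
have Ige' : 1 <= I * (q + 1) by rewrite -ler_pdivrMr.
have Ile' : I * (q + 1) <= (r + 1) / (r - 1) by rewrite -ler_pdivlMr // -mulrA -invfM.
apply/andP; split.
  apply: (@le_trans _ _ (Num.sqrt c)^-1); last by rewrite ler_peMl // invr_ge0 ltW.
  by rewrite -[leLHS]invrK lef_pV2 ?posrE ?invr_gt0 ?divr_gt0 ?invf_div //; lra.
apply: le_trans Ile'; rewrite ler_pdivrMr // ler_peMr //; lra.
Qed.

Theorem mainTheorem8 (R : realType) (p t s : nat -> nat) (F : nat -> finFieldType) :
  (forall n, [/\ prime (p n), odd (p n), (0 < t n)%N, (0 < s n)%N
             & #|F n| = ((p n ^ (t n * s n)) ^ 2)%N]) ->
  (forall M : nat, exists N0 : nat, forall n, (N0 <= n)%N -> (M <= p n ^ t n)%N) ->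
  (fun n => codebookRatio (F n) (p n) (t n) (s n) R) @ \oo --> (1 : R).
Proof.
move=> H rinf.
have bounds n : ((p n ^ t n)%:R - 1) / ((p n ^ t n)%:R + 2) <=
    codebookRatio (F n) (p n) (t n) (s n) R <=
    ((p n ^ t n)%:R + 1) / ((p n ^ t n)%:R - 1).
  have [pp podd t0 s0 cF] := H n.
  have p3 : (3 <= p n)%N by move: podd (prime_gt1 pp); case: (p n) => [|[|[|]]].
  have r3 : (3 <= p n ^ t n)%N.
    by apply: leq_trans p3 _; rewrite -{1}(expn1 (p n)) leq_pexp2l // prime_gt0.
  rewrite /codebookRatio /welch /NN /qq /rr -(expnM (p n)) [((p n ^ (t n * s n)) ^ 2)%:R]natrX.
  apply: welch_ratio_bounds; first by rewrite ler_nat.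
  - by rewrite ler_nat leq_pexp2l ?prime_gt0 // leq_pmulr.
  - have := congr1 (fun n => n%:R : R) (card_Dset R (F n) (p n) (t n) (s n) pp podd t0 s0 cF).
    by rewrite !natrM natrD natrB // (leq_trans _ r3).
  - exact: Imax_ge.
  - exact: Imax_le.
apply/cvgrPdist_le => e e0.
(* The offset 3 secures both r - 1 >= 3/e and r >= 3. *)
have [N0 HN] := rinf (Num.truncn (3 / e)).+3.
near=> n.
have rn : 3 / e <= (p n ^ t n)%:R - 1 /\ 3 <= (p n ^ t n)%:R :> R.
  have /HN rN : (N0 <= n)%N by near: n; exact: nbhs_infty_ge.
  split; last by rewrite ler_nat (leq_trans _ rN).
  have lt3 : 3 / e < (Num.truncn (3 / e)).+1%:R := truncnS_gt _.
  have : (Num.truncn (3 / e)).+3%:R <= (p n ^ t n)%:R :> R by rewrite ler_nat.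
  by rewrite -natr1 -natr1; lra.
have := bounds n; move: rn.
move: (codebookRatio _ _ _ _ _) ((p n ^ t n)%:R : R) => x r [re r3] /andP[lo hi].
have r1 : 0 < r - 1 by lra.
have {}re : 3 / (r - 1) <= e by rewrite ler_pdivrMr // mulrC -ler_pdivrMr.
(* The upper and lower bounds differ from 1 by 2/(r-1) and 3/(r+2), both at most 3/(r-1) <= e. *)
have E1 : (r + 1) / (r - 1) = 1 + 2 / (r - 1) by field; rewrite gt_eqF; lra.
have E2 : (r - 1) / (r + 2) = 1 - 3 / (r + 2) by field; rewrite gt_eqF; lra.
have L1 : 2 / (r - 1) <= 3 / (r - 1) by rewrite ler_wpM2r ?invr_ge0; lra.
have L2 : 3 / (r + 2) <= 3 / (r - 1).
  by rewrite ler_wpM2l ?lef_pV2 ?posrE; lra.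
by rewrite ler_norml; apply/andP; split; lra.
Unshelve. all: by end_near.
Qed.
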